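(* Let $n\ge 1$ and let $A,B$ be $n\times n$ complex Hermitian matrices. Put $H=A+B$, $Q_3=A^3+3A^2B+3AB^2+B^3$ and $\operatorname{Re}Q_3=\frac12(Q_3+Q_3^* )$. Then \[ \lambda(H^3)\prec \lambda(\operatorname{Re}Q_3), \] and consequently \[ \lambda(H^3)\prec_w \sigma(Q_3). \]
   Context: For an $n\times n$ Hermitian matrix $X$, $\lambda(X)=(\lambda_1(X),\dots,\lambda_n(X))$ is the vector of eigenvalues, counted with multiplicity, in nonincreasing order. For an $n\times n$ complex matrix $Y$, $\sigma(Y)=(\sigma_1(Y),\dots,\sigma_n(Y))$ is the vector of singular values in nonincreasing order. For $x,y\in\mathbb{R}^n$ with entries in nonincreasing order, $x\prec_w y$ ($x$ is weakly majorized by $y$) means $\sum_{i=1}^r x_i\le\sum_{i=1}^r y_i$ for all $r=1,\dots,n$; $x\prec y$ ($x$ is majorized by $y$) means $x\prec_w y$ and in addition $\sum_{i=1}^n x_i=\sum_{i=1}^n y_i$. *)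

(* Defs.v *)
From mathcomp Require Import all_boot all_order all_algebra.
From mathcomp Require Import complex reals.

Set Implicit Arguments.
Unset Strict Implicit.
Unset Printing Implicit Defensive.

Import Order.TTheory GRing.Theory Num.Theory.
Local Open Scope ring_scope.
Local Open Scope complex_scope.
Local Open Scope sesquilinear_scope.

(* The roots of the characteristic polynomial, with algebraic multiplicity.
   Meant for Hermitian [X], where taking real parts loses nothing: see
   [char_poly_eigvals]. *)
Definition eigval_seq (R : realType) (n : nat) (X : 'M[R[i]]_n) : seq R :=
  sort >=%R
    [seq complex.Re z | z <- sval (closed_field_poly_normal (char_poly X))].

Definition eigvals (R : realType) (n : nat) (X : 'M[R[i]]_n) : 'rV[R]_n :=
  \row_(k < n) (eigval_seq X)`_k.

Definition singvals (R : realType) (n : nat) (Y : 'M[R[i]]_n) : 'rV[R]_n :=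
  \row_(k < n) Num.sqrt (eigvals (Y ^t* *m Y) 0 k).

(* Meant for vectors with nonincreasing entries: there is no rearrangement. *)
Definition weakly_majorized (R : realType) (n : nat) (x y : 'rV[R]_n) : Prop :=
  forall r : nat, (1 <= r <= n)%N ->
    \sum_(k < n | (k < r)%N) x 0 k <= \sum_(k < n | (k < r)%N) y 0 k.

Definition majorized (R : realType) (n : nat) (x y : 'rV[R]_n) : Prop :=
  weakly_majorized x y /\ \sum_k x 0 k = \sum_k y 0 k.

Definition hermitian_part (R : realType) (n : nat) (Y : 'M[R[i]]_n) :
  'M[R[i]]_n := 2^-1 *: (Y + Y ^t*).

Definition Q3 (R : realType) (n : nat) (A B : 'M[R[i]]_n) : 'M[R[i]]_n :=
  A ^+ 3 + (A ^+ 2 * B) *+ 3 + (A * B ^+ 2) *+ 3 + B ^+ 3.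

Lemma size_eigval_seq (R : realType) (n : nat) (X : 'M[R[i]]_n) :
  size (eigval_seq X) = n.
Proof.
rewrite size_sort size_map; case: closed_field_poly_normal => rs /= Hrs.
have := size_char_poly X.
rewrite Hrs (monicP (char_poly_monic X)) scale1r size_prod_XsubC.
by case.
Qed.

Lemma eigvals_nonincreasing (R : realType) (n : nat) (X : 'M[R[i]]_n)
    (j k : 'I_n) : (j <= k)%N -> eigvals X 0 k <= eigvals X 0 j.
Proof.
move=> le_jk; rewrite !mxE.
have tr : transitive (>=%R : rel R).
  by move=> a b c /= ba ca; exact: le_trans ca ba.
have rf : reflexive (>=%R : rel R) by move=> a /=.
have tt : total (>=%R : rel R) by move=> a b /=; exact: le_total.
apply: (sorted_leq_nth tr rf 0 (sort_sorted tt _)) le_jk;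
  by rewrite inE size_eigval_seq.
Qed.

Lemma singvals_nonincreasing (R : realType) (n : nat) (Y : 'M[R[i]]_n)
    (j k : 'I_n) : (j <= k)%N -> singvals Y 0 k <= singvals Y 0 j.
Proof.
move=> le_jk; have := eigvals_nonincreasing (Y ^t* *m Y) le_jk.
by rewrite !mxE; exact: ler_wsqrtr.
Qed.

Lemma hermitian_root_real (R : realType) (n : nat) (X : 'M[R[i]]_n) (z : R[i]) :
  X \is hermsymmx -> root (char_poly X) z -> (complex.Re z)%:C = z.
Proof.
move=> hX; rewrite -eigenvalue_root_char => /eigenvalueP[v vX v0].
have XE : X ^t* = X by move: hX => /is_hermitianmxP; rewrite expr0 scale1r => <-.
have vXt : X *m v ^t* = Num.conj z *: v ^t*.
  by rewrite -{1}XE -map_mxM -trmx_mul vX linearZ /= map_mxZ.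
have vv : z *: (v *m v ^t*) = Num.conj z *: (v *m v ^t*).
  by rewrite scalemxAl -vX -mulmxA vXt -scalemxAr.
have v1 : (v *m v ^t*) 0 0 != 0.
  apply: contra v0; rewrite mxE psumr_eq0 => [/allP h|k _]; last first.
    by rewrite !mxE mul_conjC_ge0.
  apply/eqP/rowP=> k; have := h k (mem_index_enum _); rewrite !mxE /=.
  by rewrite mul_conjC_eq0 => /eqP.
move/matrixP/(_ 0 0): vv; rewrite !mxE => /(mulIf _) zz.
have {}zz : z = Num.conj z by apply: zz; move: v1; rewrite mxE.
case: z zz {vX vXt} => a b; rewrite /= => -[/eqP].
by rewrite -addr_eq0 -mulr2n mulrn_eq0 /= => /eqP ->.
Qed.

Lemma char_poly_eigvals (R : realType) (n : nat) (X : 'M[R[i]]_n) :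
  X \is hermsymmx ->
  char_poly X = \prod_(k < n) ('X - ((eigvals X 0 k)%:C)%:P).
Proof.
move=> hX; have sz := size_eigval_seq X.
under eq_bigr => k _ do rewrite mxE.
rewrite -(big_mkord predT (fun k => 'X - (((eigval_seq X)`_k)%:C)%:P)).
rewrite -{2}sz -(big_nth 0 predT (fun x : R => 'X - (x%:C)%:P)).
rewrite /eigval_seq (perm_big _ (permEl (perm_sort _ _))) /= big_map.
case: closed_field_poly_normal => rs /= Hrs.
move: Hrs; rewrite (monicP (char_poly_monic X)) scale1r => Hrs.
rewrite [LHS]Hrs big_seq [RHS]big_seq; apply: eq_bigr => z zrs.
by rewrite (hermitian_root_real hX) // Hrs root_prod_XsubC.
Qed.

(* Main.v *)
(* With [D = A - B] one has
     Re Q_3 - H^3 = [D, [D, H]] / 4.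
   In an orthonormal eigenbasis of [H], with eigenvalues [h_k] in nonincreasing
   order, the [k]-th diagonal entry of this difference is
     (1/2) \sum_j |D_kj|^2 (h_k - h_j).
   Summed over [k < r], the terms with [j < r] cancel by antisymmetry and the
   others are nonnegative. Hence the partial sums of [h_k^3] are at most those of
   the diagonal of [Re Q_3], which by Schur are at most those of its eigenvalues;
   for [r = n] all these sums agree. Weak majorization by the singular values
   follows from the Fan-Hoffman inequality [lambda_k (Re Y) <= sigma_k Y]. *)
Require Import Defs.
From mathcomp Require Import all_boot all_order all_algebra.
From mathcomp Require Import complex reals perm ring lra.

Set Implicit Arguments.
Unset Strict Implicit.
Unset Printing Implicit Defensive.

Import Order.TTheory GRing.Theory Num.Theory.
Local Open Scope ring_scope.
Local Open Scope complex_scope.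
Local Open Scope sesquilinear_scope.

(** * Squared moduli, adjoints and unitary matrices *)

(** The product [z * Num.conj z] taken as an element of [R], so that sums of such weights can be
    compared in [R]. *)
Definition sqmod (R : realType) (z : R[i]) : R :=
  complex.Re z ^+ 2 + complex.Im z ^+ 2.

Definition rdiag_mx (R : realType) (n : nat) (d : 'rV[R]_n) : 'M[R[i]]_n :=
  diag_mx (map_mx (real_complex R) d).

Lemma sqmod_ge0 (R : realType) (z : R[i]) : 0 <= sqmod z.
Proof. by rewrite addr_ge0 ?sqr_ge0. Qed.

Lemma sqmod_gt0 (R : realType) (z : R[i]) : z != 0 -> 0 < sqmod z.
Proof.
move=> z0; rewrite lt_def sqmod_ge0 andbT; apply: contra z0.
rewrite paddr_eq0 ?sqr_ge0 // !sqrf_eq0 => /andP[/eqP h1 /eqP h2].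
by rewrite eq_complex h1 h2 !eqxx.
Qed.

Lemma mul_conj_sqmod (R : realType) (z : R[i]) : z * Num.conj z = (sqmod z)%:C.
Proof.
by case: z => a b; apply/eqP; rewrite eq_complex /sqmod /=; apply/andP; split;
  apply/eqP; ring.
Qed.

Lemma hermsymmx_trmxC (R : realType) (n : nat) (X : 'M[R[i]]_n) :
  (X \is hermsymmx) = (X ^t* == X).
Proof.
apply/idP/eqP => [/is_hermitianmxP | XE]; first by rewrite expr0 scale1r => <-.
by apply/is_hermitianmxP; rewrite expr0 scale1r XE.
Qed.

Lemma trmxC_mul (R : realType) (m n p : nat) (X : 'M[R[i]]_(m, n))
  (Y : 'M[R[i]]_(n, p)) : (X *m Y) ^t* = Y ^t* *m X ^t*.
Proof. by rewrite trmx_mul map_mxM. Qed.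

Lemma trmxCD (R : realType) (m n : nat) (X Y : 'M[R[i]]_(m, n)) :
  (X + Y) ^t* = X ^t* + Y ^t*.
Proof. by rewrite linearD /= map_mxD. Qed.

Lemma trmxCB (R : realType) (m n : nat) (X Y : 'M[R[i]]_(m, n)) :
  (X - Y) ^t* = X ^t* - Y ^t*.
Proof. by rewrite linearB /= map_mxB. Qed.

Lemma unitarymx_trmxC_mul (R : realType) (n : nat) (U : 'M[R[i]]_n) :
  U \is unitarymx -> U ^t* *m U = 1%:M.
Proof. by move=> hU; rewrite -invmx_unitary // mulVmx // unitarymx_unit. Qed.

Lemma rdiag_quadratic_form (R : realType) (m n : nat) (W : 'M[R[i]]_(m, n))
    (d : 'rV[R]_n) (k : 'I_m) :
  (W *m rdiag_mx d *m W ^t*) k k = (\sum_j sqmod (W k j) * d 0 j)%:C.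
Proof.
rewrite mxE rmorph_sum; apply: eq_bigr => j _.
by rewrite mul_mx_diag !mxE mulrAC mul_conj_sqmod rmorphM.
Qed.

Lemma sqmod_row_sum (R : realType) (m n : nat) (W : 'M[R[i]]_(m, n)) (k : 'I_m) :
  (W *m W ^t*) k k = (\sum_j sqmod (W k j))%:C.
Proof.
by rewrite mxE rmorph_sum; apply: eq_bigr => j _; rewrite !mxE mul_conj_sqmod.
Qed.

Lemma unitary_sqmod_row (R : realType) (n : nat) (W : 'M[R[i]]_n) (k : 'I_n) :
  W \is unitarymx -> \sum_j sqmod (W k j) = 1.
Proof.
move=> /unitarymxP hW; apply: complexI; rewrite -sqmod_row_sum hW mxE eqxx.
by rewrite rmorph1.
Qed.

Lemma unitary_sqmod_col (R : realType) (n : nat) (W : 'M[R[i]]_n) (j : 'I_n) :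
  W \is unitarymx -> \sum_k sqmod (W k j) = 1.
Proof.
move=> hW; rewrite -(@unitary_sqmod_row _ _ (W ^T) j) ?trmx_unitary //.
by apply: eq_bigr => k _; rewrite mxE.
Qed.

(** * Spectral decomposition with sorted eigenvalues *)

Lemma char_poly_rdiag_conj (R : realType) (n : nat) (U X : 'M[R[i]]_n)
    (d : 'rV[R]_n) : U \is unitarymx -> X = U ^t* *m rdiag_mx d *m U ->
  char_poly X = \prod_(k < n) ('X - ((d 0 k)%:C)%:P).
Proof.
move=> hU XE; have UU := unitarymx_trmxC_mul hU.
transitivity (char_poly (rdiag_mx d)).
  have fUU : map_mx polyC (U ^t*) *m map_mx polyC U = 1%:M.
    by rewrite -map_mxM UU map_mx1.
  rewrite /char_poly /char_poly_mx XE !map_mxM.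
  (* Scalar matrices are central, so ['X%:M] can be conjugated along with the diagonal matrix. *)
  have {1}-> : 'X%:M = map_mx polyC (U ^t*) *m 'X%:M *m map_mx polyC U :> 'M_n.
    by rewrite scalar_mxC -mulmxA fUU mulmx1.
  rewrite -mulmxBl -mulmxBr !det_mulmx mulrAC -det_mulmx fUU det1.
  by rewrite mul1r.
rewrite char_poly_trig ?diag_mx_is_trig //.
by apply: eq_bigr => k _; rewrite !mxE eqxx mulr1n.
Qed.

Lemma rdiag_conj_hermsymmx (R : realType) (m n : nat) (U : 'M[R[i]]_(m, n))
  (d : 'rV[R]_m) : U ^t* *m rdiag_mx d *m U \is hermsymmx.
Proof.
rewrite hermsymmx_trmxC !trmxC_mul trmxCK -mulmxA; apply/eqP; congr (_ *m (_ *m _)).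
apply/matrixP => i j; rewrite !mxE eq_sym; case: eqVneq => [->|_].
  by rewrite !mulr1n; apply/eqP; rewrite eq_complex /= oppr0 !eqxx.
by rewrite !mulr0n rmorph0.
Qed.

(** Both families are the roots of the characteristic polynomial of [X], which determines them up to
    order; the embedding of [R] in [R[i]] is injective. *)
Lemma perm_eq_eigvals (R : realType) (n : nat) (U X : 'M[R[i]]_n)
    (d : 'rV[R]_n) : U \is unitarymx -> X = U ^t* *m rdiag_mx d *m U ->
  perm_eq (codom (eigvals X 0)) (codom (d 0)).
Proof.
move=> hU XE; apply: (perm_map_inj (@complexI R)).
apply: prod_XsubC_eq; rewrite !(big_map (real_complex R)) !big_image /=.
rewrite -(char_poly_rdiag_conj hU XE) char_poly_eigvals //.
by rewrite XE rdiag_conj_hermsymmx.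
Qed.

Lemma sorted_codom_row (R : realType) (n : nat) (d : 'rV[R]_n) :
  {homo d 0 : j k / (j <= k)%N >-> k <= j} -> sorted >=%R (codom (d 0)).
Proof.
move=> hd; rewrite /codom /image_mem sorted_map.
have: sorted ltn (map val (enum 'I_n)) by rewrite val_enum_ord iota_ltn_sorted.
rewrite sorted_map; apply: sub_sorted => j k /= /ltnW jk; exact: hd.
Qed.

Lemma eigvals_unique (R : realType) (n : nat) (U X : 'M[R[i]]_n) (d : 'rV[R]_n) :
    U \is unitarymx -> X = U ^t* *m rdiag_mx d *m U ->
    {homo d 0 : j k / (j <= k)%N >-> k <= j} ->
  eigvals X = d.
Proof.
move=> hU XE hd.
have: codom (eigvals X 0) = codom (d 0).
  apply: (@sorted_eq _ >=%R _ _ _ _ _ _ (perm_eq_eigvals hU XE)).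
  - by move=> a b c /= ba ca; exact: le_trans ca ba.
  - by move=> a b /= /le_anti.
  - by apply: sorted_codom_row => j k; apply: eigvals_nonincreasing.
  - exact: sorted_codom_row.
by move=> /eq_in_map E; apply/rowP => k; apply: E; rewrite mem_enum.
Qed.

(** [spectralmx] diagonalizes [X] with the eigenvalues in an unspecified order; permuting its rows
    puts them in the order of [eigvals]. *)
Lemma hermitian_spectral (R : realType) (n : nat) (X : 'M[R[i]]_n) :
    X \is hermsymmx ->
  exists2 U, U \is unitarymx & X = U ^t* *m rdiag_mx (eigvals X) *m U.
Proof.
move=> hX; set P := spectralmx X; have hP : P \is unitarymx.
  exact: spectral_unitarymx.
pose d := map_mx (@complex.Re R) (spectral_diag X).
have XE : X = P ^t* *m rdiag_mx d *m P.
  have /orthomx_spectralP := hermitian_normalmx hX.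
  rewrite -/P invmx_unitary // => {1}->; congr (_ *m diag_mx _ *m _).
  apply/rowP => k; rewrite !mxE RRe_real //.
  by have /mxOverP/(_ 0 k) := hermitian_spectral_diag_real hX.
have /tuple_permP[p pE] : perm_eq (codom (eigvals X 0)) [tuple d 0 k | k < n].
  exact: perm_eq_eigvals hP XE.
have eE k : eigvals X 0 k = d 0 (p k).
  have {}pE : [tuple eigvals X 0 i | i < n] =
    [tuple tnth [tuple d 0 k | k < n] (p i) | i < n] by exact: val_inj.
  by have := congr1 (fun t => tnth t k) pE; rewrite !tnth_mktuple.
exists (row_perm p P).
  apply/unitarymxP/matrixP => i j; move/unitarymxP/matrixP/(_ (p i) (p j)): hP.
  rewrite !mxE (inj_eq perm_inj) => <-; apply: eq_bigr => k _.
  by rewrite !mxE.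
rewrite [LHS]XE !mul_mx_diag; apply/matrixP => i j.
rewrite [LHS]mxE [RHS]mxE (reindex_inj (@perm_inj _ p)) /=.
apply: eq_bigr => k _; by have := eE k; rewrite !mxE => <-.
Qed.

(** * Schur's inequality for diagonals of Hermitian matrices *)

(* Each term of [\sum_j (1_(j < r) - c_j) (d_j - d_(r-1))] is nonnegative. *)
Lemma sum_top_max (R : realType) (n r : nat) (c d : 'rV[R]_n) :
    (1 <= r <= n)%N -> {homo d 0 : j k / (j <= k)%N >-> k <= j} ->
    (forall j, 0 <= c 0 j <= 1) -> \sum_j c 0 j = r%:R ->
  \sum_j c 0 j * d 0 j <= \sum_(j < n | (j < r)%N) d 0 j.
Proof.
move=> /andP[r1 rn] hd hc sc.
have rn' : (r.-1 < n)%N by rewrite prednK.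
pose t := d 0 (Ordinal rn').
have s1 : \sum_(j < n) ((j < r)%N%:R : R) = r%:R.
  under eq_bigr do rewrite mulrb.
  by rewrite -big_mkcond /= (big_ord_narrow rn) /= sumr_const card_ord.
rewrite [leRHS]big_mkcond /= -subr_ge0 -sumrB.
(* Subtracting [t] from every [d 0 j] changes nothing, since the indicator weights and the [c 0 j]
   have the same total [r]. *)
have -> : \sum_(j < n) ((if (j < r)%N then d 0 j else 0) - c 0 j * d 0 j) =
  \sum_(j < n) (((j < r)%N%:R - c 0 j) * (d 0 j - t)).
  apply/eqP; rewrite -subr_eq0 -sumrB.
  under eq_bigr => j _.
    rewrite (_ : _ - _ = ((j < r)%N%:R - c 0 j) * t); last first.
      by case: (j < r)%N => /=; ring.
    over.
  by rewrite -mulr_suml sumrB s1 sc subrr mul0r.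
apply: sumr_ge0 => j _; have /andP[c0 c1] := hc j.
case: ltnP => jr.
  by rewrite mulr_ge0 ?subr_ge0 //; apply: hd; rewrite /= -ltnS prednK.
rewrite -mulrNN mulr_ge0 ?opprB ?subr_ge0 ?c0 //.
by apply: hd; rewrite /= (leq_trans _ jr) // leq_pred.
Qed.

(** The columns of [V] are an orthonormal eigenbasis of [M]. When [U] is unitary, so is [U *m V],
    and the weights form a doubly stochastic matrix. *)
Lemma hermitian_conj_diag (R : realType) (n : nat) (M : 'M[R[i]]_n) :
    M \is hermsymmx ->
  exists2 V, V \is unitarymx & forall (U : 'M_n) k, complex.Re ((U *m M *m U ^t*) k k) =
     \sum_j sqmod ((U *m V) k j) * eigvals M 0 j.
Proof.
move=> /hermitian_spectral[V hV ME]; exists (V ^t*); first by rewrite trmxC_unitary.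
move=> U k; rewrite {1}ME.
rewrite (_ : U *m _ *m _ = (U *m V^t*) *m rdiag_mx (eigvals M) *m (U *m V^t*)^t*).
  by rewrite rdiag_quadratic_form.
by rewrite trmxC_mul trmxCK !mulmxA.
Qed.

Lemma schur_weak_majorization (R : realType) (n r : nat) (M U : 'M[R[i]]_n) :
    (1 <= r <= n)%N -> M \is hermsymmx -> U \is unitarymx ->
  \sum_(k < n | (k < r)%N) complex.Re ((U *m M *m U ^t*) k k) <=
  \sum_(k < n | (k < r)%N) eigvals M 0 k.
Proof.
move=> rn /hermitian_conj_diag[V hV hM] hU.
have hW : U *m V \is unitarymx by rewrite mul_unitarymx.
under eq_bigr do rewrite hM.
rewrite exchange_big /=.
(* Column sums over the first [r] rows of a doubly stochastic matrix: each lies in [0, 1] and their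
   total is [r]. *)
pose c := \row_j \sum_(k < n | (k < r)%N) sqmod ((U *m V) k j).
under eq_bigr => j _.
  rewrite -mulr_suml (_ : \sum_(k < n | _) _ = c 0 j); last by rewrite mxE.
  over.
apply: sum_top_max => //.
- by move=> j k; apply: eigvals_nonincreasing.
- move=> j; rewrite mxE sumr_ge0 => [|k _]; last exact: sqmod_ge0.
  rewrite -(unitary_sqmod_col j hW) [leRHS](bigID (fun k : 'I_n => (k < r)%N)) /=.
  by rewrite lerDl sumr_ge0 // => k _; exact: sqmod_ge0.
- under eq_bigr do rewrite mxE.
  rewrite exchange_big /=.
  under eq_bigr do rewrite (unitary_sqmod_row _ hW).
  by rewrite (big_ord_narrow (andP rn).2) /= sumr_const card_ord.
Qed.

Lemma sum_diag_eigvals (R : realType) (n : nat) (M U : 'M[R[i]]_n) :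
    M \is hermsymmx -> U \is unitarymx ->
  \sum_k complex.Re ((U *m M *m U ^t*) k k) = \sum_k eigvals M 0 k.
Proof.
move=> /hermitian_conj_diag[V hV hM] hU.
under eq_bigr do rewrite hM.
rewrite exchange_big /=; apply: eq_bigr => j _.
by rewrite -mulr_suml unitary_sqmod_col ?mul1r // mul_unitarymx.
Qed.

(** * The Fan-Hoffman inequality *)

Lemma hermitian_part_hermsymmx (R : realType) (n : nat) (Y : 'M[R[i]]_n) :
  hermitian_part Y \is hermsymmx.
Proof.
rewrite hermsymmx_trmxC /hermitian_part linearZ /= map_mxZ -/(_ ^t*).
rewrite trmxCD trmxCK addrC rmorphV ?unitfE ?pnatr_eq0 //.
by rewrite rmorph_nat.
Qed.

(* The intersection of the span of the first [k + 1] unit vectors with the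
   preimage under [W] of the span of the last [n - k] is nonzero: this is the
   kernel of a square matrix with a zero column. *)
Lemma exists_mixed_support (F : fieldType) (n : nat) (W : 'M[F]_n) (k : 'I_n) :
  exists2 a : 'rV[F]_n, a != 0 &
    (forall j : 'I_n, (k < j)%N -> a 0 j = 0) /\
    (forall j : 'I_n, (j < k)%N -> (a *m W) 0 j = 0).
Proof.
pose T := \matrix_(i, j) (if (j < k)%N then W i j else
                          if j == k then 0 else (i == j)%:R).
have /det0P[a a0 aT] : \det T == 0.
  rewrite (expand_det_col _ k) big1 // => i _.
  by rewrite mxE ltnn eqxx mul0r.
exists a => //; split=> j jk; move/rowP/(_ j): aT; rewrite !mxE.
  under eq_bigr do rewrite mxE ltnNge (ltnW jk) /= -val_eqE gtn_eqF //.
  rewrite (bigD1 j) //= eqxx mulr1 big1 ?addr0 // => i /negPf ->.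
  by rewrite mulr0.
by under eq_bigr do rewrite mxE jk.
Qed.

(* Expand [0 <= |Y x^* - t x^*|^2]. *)
Lemma hermitian_part_form_bound (R : realType) (n : nat) (Y : 'M[R[i]]_n)
    (x : 'rV[R[i]]_n) (l s N t : R) :
    (x *m hermitian_part Y *m x ^t*) 0 0 = l%:C ->
    (x *m (Y ^t* *m Y) *m x ^t*) 0 0 = s%:C ->
    (x *m x ^t*) 0 0 = N%:C ->
  0 <= s - t * l * 2 + t ^+ 2 * N.
Proof.
move=> xM xY xx; pose z := x *m Y ^t* - t%:C *: x.
suff -> : s - t * l * 2 + t ^+ 2 * N = \sum_j sqmod (z 0 j).
  by rewrite sumr_ge0 // => j _; exact: sqmod_ge0.
apply: complexI; rewrite -sqmod_row_sum.
have zz : z *m z ^t* = x *m (Y ^t* *m Y) *m x ^t*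
    - (t%:C * 2) *: (x *m hermitian_part Y *m x ^t*)
    + (t%:C ^+ 2) *: (x *m x ^t*).
  have -> : z ^t* = Y *m x ^t* - t%:C *: x ^t*.
    rewrite trmxCB trmxC_mul trmxCK linearZ /= map_mxZ; congr (_ - _ *: _).
    by apply/eqP; rewrite eq_complex /= oppr0 !eqxx.
  rewrite /hermitian_part -scalemxAr -scalemxAl scalerA mulfK ?pnatr_eq0 //.
  rewrite /z !(mulmxDl, mulmxDr, mulNmx, mulmxN) -!scalemxAl -!scalemxAr !mulmxA.
  move: (x *m Y ^t* *m Y *m x ^t*) (x *m Y *m x ^t*) (x *m Y ^t* *m x ^t*)
    (x *m x ^t*) t%:C => m1 m2 m3 m4 c.
  by apply/matrixP => i j; rewrite !mxE; ring.
have mxE3 (m1 m2 m3 : 'M[R[i]]_1) (c d : R[i]) :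
    (m1 - c *: m2 + d *: m3) 0 0 = m1 0 0 - c * m2 0 0 + d * m3 0 0.
  by rewrite !mxE.
rewrite zz mxE3 xY xM xx mulrAC.
by rewrite rmorphD rmorphB /= !(rmorphM (real_complex R)) /= rmorph_nat.
Qed.

(** The hypotheses chain as [u ^+ 2 * N <= 2 * u * L - u ^+ 2 * N <= S <= v * N]. Here [N], [L] and
    [S] stand for |x|^2 and the forms of Re Y and Y^*Y at x. *)
Lemma sqr_le_of_form_bound (R : realType) (N L S u v : R) :
    0 < N -> u * N <= L -> S <= v * N -> 0 < u ->
  0 <= S - u * L * 2 + u ^+ 2 * N -> u ^+ 2 <= v.
Proof.
move=> N_gt0 uL Sv u0 S_ge; rewrite -(ler_pM2r N_gt0).
by have := ler_wpM2l (ltW u0) uL; lra.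
Qed.

(** A dimension count as in Courant-Fischer: some nonzero [x] lies both in the span of the top
    [k + 1] eigenvectors of [M] and in that of the bottom [n - k] eigenvectors of [Y ^t* *m Y]. Its
    two forms are then bounded by the [k]-th eigenvalues. *)
Lemma fan_hoffman (R : realType) (n : nat) (Y : 'M[R[i]]_n) (k : 'I_n) :
  eigvals (hermitian_part Y) 0 k <= singvals Y 0 k.
Proof.
have hM := hermitian_part_hermsymmx Y; set M := hermitian_part Y in hM *.
have hYY : Y ^t* *m Y \is hermsymmx.
  by rewrite hermsymmx_trmxC trmxC_mul trmxCK.
have [U hU ME] := hermitian_spectral hM.
have [V hV YE] := hermitian_spectral hYY.
rewrite [leRHS]mxE.
set l := eigvals M in ME *; set s := eigvals (Y ^t* *m Y) in YE *.
have [a a0 [a_lo b_hi]] := exists_mixed_support (U *m V ^t*) k.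
have [x xE] : exists x, x = a *m U by exists (a *m U).
have [b bE] : exists b, b = x *m V ^t* by exists (x *m V ^t*).
have {}b_hi (j : 'I_n) : (j < k)%N -> b 0 j = 0.
  by rewrite bE xE -mulmxA; exact: b_hi.
have [N NE] : exists N, N = \sum_j sqmod (a 0 j) by eexists.
have N_gt0 : 0 < N.
  have /rV0Pn[j aj] := a0.
  rewrite NE (bigD1 j) //= ltr_pwDl ?sqmod_gt0 // sumr_ge0 // => *.
  exact: sqmod_ge0.
have xx : (x *m x ^t*) 0 0 = N%:C.
  by rewrite NE -sqmod_row_sum xE trmxC_mul mulmxA mulmxtVK.
have bN : \sum_j sqmod (b 0 j) = N.
  apply: complexI; rewrite -xx -sqmod_row_sum bE trmxC_mul trmxCK mulmxA.
  by rewrite -(mulmxA x) unitarymx_trmxC_mul // mulmx1.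
have xM : (x *m M *m x ^t*) 0 0 = (\sum_j sqmod (a 0 j) * l 0 j)%:C.
  by rewrite -rdiag_quadratic_form ME xE trmxC_mul !mulmxA !mulmxtVK.
have xY : (x *m (Y ^t* *m Y) *m x ^t*) 0 0 = (\sum_j sqmod (b 0 j) * s 0 j)%:C.
  by rewrite -rdiag_quadratic_form YE bE trmxC_mul trmxCK !mulmxA.
have lN : l 0 k * N <= \sum_j sqmod (a 0 j) * l 0 j.
  rewrite NE mulr_sumr; apply: ler_sum => j _.
  have [kj|jk] := ltnP k j; first by rewrite a_lo // /sqmod !expr0n addr0 mulr0 mul0r.
  by rewrite mulrC ler_wpM2l ?sqmod_ge0 ?eigvals_nonincreasing.
have sN : \sum_j sqmod (b 0 j) * s 0 j <= s 0 k * N.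
  rewrite -bN mulr_sumr; apply: ler_sum => j _.
  have [jk|kj] := ltnP j k; first by rewrite b_hi // /sqmod !expr0n addr0 mulr0 mul0r.
  by rewrite mulrC ler_wpM2r ?sqmod_ge0 ?eigvals_nonincreasing.
(* A nonpositive eigenvalue lies below any square root; a positive one serves as the parameter [t]
   of the form bound. *)
have [l0|l0] := lerP (l 0 k) 0; first exact: le_trans l0 (sqrtr_ge0 _).
have /ler_wsqrtr := sqr_le_of_form_bound N_gt0 lN sN l0
  (hermitian_part_form_bound (l 0 k) xM xY xx).
by rewrite sqrtr_sqr ger0_norm // ltW.
Qed.

(** * The double commutator and its diagonal *)

Lemma hermitian_part_Q3 (R : realType) (n : nat) (A B : 'M[R[i]]_n)
    (H := A + B) (D := A - B) :
    A \is hermsymmx -> B \is hermsymmx ->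
  hermitian_part (Q3 A B) =
    H ^+ 3 + 4^-1 *: (D * D * H + H * D * D - (D * H * D) *+ 2).
Proof.
rewrite !hermsymmx_trmxC => /eqP hA /eqP hB.
have trmxC_mulr (X Y : 'M[R[i]]_n) : (X * Y) ^t* = Y ^t* * X ^t*.
  exact: trmxC_mul.
rewrite /hermitian_part /Q3.
have -> : (A ^+ 3 + A ^+ 2 * B *+ 3 + A * B ^+ 2 *+ 3 + B ^+ 3) ^t* =
  A ^+ 3 + B * A ^+ 2 *+ 3 + B ^+ 2 * A *+ 3 + B ^+ 3.
  rewrite !exprS !expr0 !mulr1 !mulrSr !mulr0n !add0r.
  by rewrite !trmxCD !trmxC_mulr hA hB !mulrA.
rewrite {}/H {}/D !exprS !expr0 !mulr1 !(mulrDl, mulrDr, mulrBl, mulrBr) !mulrA.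
rewrite !(mulrN, mulNr, mulrBl, mulrBr, mulrDr, mulrDl, mulrA).
(* The eight noncommutative words become independent matrices, which leaves a linear identity in
   each entry. *)
move: (A * A * A) (A * A * B) (A * B * A) (B * A * A) (A * B * B) (B * A * B)
  (B * B * A) (B * B * B) => m1 m2 m3 m4 m5 m6 m7 m8.
by apply/matrixP => i j; rewrite !mxE; field.
Qed.

Lemma sqmod_conj (R : realType) (z : R[i]) : sqmod (Num.conj z) = sqmod z.
Proof. by case: z => a b; rewrite /sqmod /= sqrrN. Qed.

Lemma unitary_conj_mul (R : realType) (n : nat) (U X Y : 'M[R[i]]_n) :
    U \is unitarymx ->
  U *m (X * Y) *m U ^t* = (U *m X *m U ^t*) * (U *m Y *m U ^t*).
Proof. by move=> hU; rewrite /GRing.mul /= !mulmxA mulmxKtV. Qed.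

Lemma unitary_conjK (R : realType) (n : nat) (U X : 'M[R[i]]_n) :
  U \is unitarymx -> U ^t* *m (U *m X *m U ^t*) *m U = X.
Proof.
move=> hU; rewrite !mulmxA unitarymx_trmxC_mul // mul1mx.
by rewrite -mulmxA unitarymx_trmxC_mul // mulmx1.
Qed.

Lemma unitary_conj_double_commutator (R : realType) (n : nat)
    (U D H K L : 'M[R[i]]_n) :
    U \is unitarymx -> U *m D *m U ^t* = K -> U *m H *m U ^t* = L ->
  U *m (D * D * H + H * D * D - (D * H * D) *+ 2) *m U ^t* =
  K * K * L + L * K * K - (K * L * K) *+ 2.
Proof.
move=> hU <- <-; rewrite !mulr2n !(mulmxDr, mulmxDl, mulmxN, mulNmx).
have conjM X Y Z := unitary_conj_mul (X * Y) Z hU.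
by rewrite !conjM !(unitary_conj_mul _ _ hU).
Qed.

(** Since [K] is Hermitian, the [k]-th diagonal entry of each outer product is [h 0 k] times the
    squared norm of row [k] of [K], while the middle product weights the same squared moduli by
    [h 0 j]. *)
Lemma double_commutator_diag (R : realType) (n : nat) (K : 'M[R[i]]_n)
    (h : 'rV[R]_n) (k : 'I_n) : K ^t* = K ->
  (K * K * rdiag_mx h + rdiag_mx h * K * K - (K * rdiag_mx h * K) *+ 2) k k =
  (2 * \sum_j sqmod (K k j) * (h 0 k - h 0 j))%:C.
Proof.
move=> hK.
have KK : (K *m K) k k = (\sum_j sqmod (K k j))%:C.
  by rewrite -{2}hK sqmod_row_sum.
have KLK : (K *m rdiag_mx h *m K) k k = (\sum_j sqmod (K k j) * h 0 j)%:C.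
  by rewrite -{2}hK rdiag_quadratic_form.
have mxE3 (m1 m2 m3 : 'M[R[i]]_n) :
  (m1 + m2 - m3 *+ 2) k k = m1 k k + m2 k k - m3 k k *+ 2.
  by rewrite !mulr2n !mxE.
rewrite mxE3.
have -> : (K * K * rdiag_mx h) k k = (K *m K) k k * (h 0 k)%:C.
  by rewrite [_ * rdiag_mx h]mul_mx_diag mxE [X in _ * X]mxE.
have -> : (rdiag_mx h * K * K) k k = (h 0 k)%:C * (K *m K) k k.
  by rewrite -mulrA [rdiag_mx h * _]mul_diag_mx mxE [X in X * _]mxE.
rewrite KLK KK -!rmorphM -rmorphD -rmorphMn -rmorphB; congr _%:C.
under [in RHS]eq_bigr do rewrite mulrBr.
by rewrite sumrB -mulr_suml; ring.
Qed.

(** * Antisymmetric sums and the majorization *)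

Lemma sum_antisym (R : realType) (I : finType) (P : pred I) (s : I -> I -> R)
    (h : I -> R) : (forall k j, s k j = s j k) ->
  \sum_(k | P k) \sum_(j | P j) s k j * (h k - h j) = 0.
Proof.
move=> hs; set S := LHS.
(* Exchanging the names of the two indices reverses the sign of every term. *)
have : S = - S.
  rewrite {1}/S exchange_big /= -sumrN; apply: eq_bigr => k _.
  by rewrite -sumrN; apply: eq_bigr => j _; rewrite hs -mulrN opprB.
lra.
Qed.

Lemma sum_top_ge0 (R : realType) (n r : nat) (s : 'I_n -> 'I_n -> R)
    (h : 'rV[R]_n) :
    (forall k j, s k j = s j k) -> (forall k j, 0 <= s k j) ->
    {homo h 0 : j k / (j <= k)%N >-> k <= j} ->
  0 <= \sum_(k < n | (k < r)%N) \sum_j s k j * (h 0 k - h 0 j).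
Proof.
move=> sC s0 hh.
under eq_bigr do rewrite (bigID (fun j : 'I_n => (j < r)%N)) /=.
rewrite big_split /= sum_antisym // add0r.
apply: sumr_ge0 => k kr; apply: sumr_ge0 => j; rewrite -leqNgt => rj.
by rewrite mulr_ge0 ?subr_ge0 // hh // ltnW // (leq_trans kr).
Qed.

Lemma ler_cube (R : realType) (x y : R) : x <= y -> x ^+ 3 <= y ^+ 3.
Proof.
move=> xy; rewrite -subr_ge0.
have -> : y ^+ 3 - x ^+ 3 =
  (y - x) * ((x + y) ^+ 2 + x ^+ 2 + y ^+ 2) / 2 by field.
by rewrite !mulr_ge0 ?invr_ge0 ?subr_ge0 ?addr_ge0 ?sqr_ge0.
Qed.

Theorem theorem3p2 (R : realType) (n : nat) (n_ge1 : (1 <= n)%N)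
    (A B : 'M[R[i]]_n)
    (A_herm : A \is hermsymmx) (B_herm : B \is hermsymmx) :
  let H := A + B in
  majorized (eigvals (H ^+ 3)) (eigvals (hermitian_part (Q3 A B))) /\
  weakly_majorized (eigvals (H ^+ 3)) (singvals (Q3 A B)).
Proof.
(* The existentials keep unification from unfolding the local names. *)
move=> S; have [H HE0] : exists H, H = A + B by eexists.
rewrite {}/S -HE0.
have [M ME] : exists M, M = hermitian_part (Q3 A B) by eexists.
rewrite -ME.
have hM : M \is hermsymmx by rewrite ME; exact: hermitian_part_hermsymmx.
have hH : H \is hermsymmx.
  move: A_herm B_herm; rewrite HE0 !hermsymmx_trmxC trmxCD.
  by move=> /eqP -> /eqP ->.
have [U hU] := hermitian_spectral hH.
have hdec : {homo eigvals H 0 : j k / (j <= k)%N >-> k <= j}.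
  by move=> j k; apply: eigvals_nonincreasing.
move: (eigvals H) hdec => h hdec HE.
have UHU : U *m H *m U ^t* = rdiag_mx h.
  by rewrite HE !mulmxA !mulmxtVK // (unitarymxP hU) mul1mx.
have [h3 h3E] : exists h3, h3 = \row_j h 0 j ^+ 3 by eexists.
have UH3U : U *m H ^+ 3 *m U ^t* = rdiag_mx h3.
  rewrite !exprS expr0 mulr1 !unitary_conj_mul // UHU h3E.
  rewrite /GRing.mul /= /rdiag_mx !mulmx_diag; congr diag_mx.
  by apply/rowP => j; rewrite !mxE -!rmorphM !exprS expr0 mulr1.
(* The basis [U] also diagonalizes [H ^+ 3], and cubing is monotone on all of [R], so the cubes are
   already sorted whatever their signs. *)
have H3E : eigvals (H ^+ 3) = h3.
  apply: (eigvals_unique hU); last first.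
    by move=> j k jk; rewrite h3E !mxE ler_cube // hdec.
  by rewrite -UH3U unitary_conjK.
have [K KE] : exists K, K = U *m (A - B) *m U ^t* by eexists.
have hK : K ^t* = K.
  rewrite KE !trmxC_mul trmxCK trmxCB mulmxA.
  by move: A_herm B_herm; rewrite !hermsymmx_trmxC => /eqP -> /eqP ->.
(* The factor [2^-1] is the [4^-1] of [hermitian_part_Q3] times the 2 of
   [double_commutator_diag]. *)
have UMU k : complex.Re ((U *m M *m U ^t*) k k) =
    h3 0 k + 2^-1 * \sum_j sqmod (K k j) * (h 0 k - h 0 j).
  rewrite ME hermitian_part_Q3 // -HE0 mulmxDr mulmxDl UH3U.
  rewrite -scalemxAr -scalemxAl.
  rewrite (unitary_conj_double_commutator hU (esym KE) UHU).
  have mxE2 (m1 m2 : 'M[R[i]]_n) c : (m1 + c *: m2) k k = m1 k k + c * m2 k k.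
    by rewrite !mxE.
  rewrite mxE2 double_commutator_diag // !mxE eqxx mulr1n.
  have -> : 4^-1 = (4^-1 : R)%:C by rewrite fmorphV rmorph_nat.
  by rewrite -rmorphM -rmorphD /=; field.
have sC k j : sqmod (K k j) = sqmod (K j k) by rewrite -{1}hK !mxE sqmod_conj.
have maj : weakly_majorized (eigvals (H ^+ 3)) (eigvals M).
  move=> r rn; apply: le_trans (schur_weak_majorization rn hM hU).
  under [leRHS]eq_bigr do rewrite UMU.
  rewrite H3E big_split /= lerDl -mulr_sumr mulr_ge0 ?invr_ge0 //.
  by apply: sum_top_ge0 => // *; exact: sqmod_ge0.
split; first (split; first exact: maj).
  (* Over all indices the correction is a full antisymmetric sum, hence zero: the traces agree. *)
  apply: etrans (sum_diag_eigvals hM hU); under [RHS]eq_bigr do rewrite UMU.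
  by rewrite big_split /= -mulr_sumr sum_antisym // mulr0 addr0 H3E.
move=> r rn; apply: le_trans (maj r rn) _; rewrite ME.
by apply: ler_sum => k _; exact: fan_hoffman.
Qed.
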